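(* Let $H_0=\begin{bmatrix}A&-\frac12BW^{-1}B^T\\-2Q&-A^T\end{bmatrix}$ and, for $\alpha\ge0$, let $$H_\alpha=\begin{bmatrix}A-\frac\alpha2I_n&-\frac12BW^{-1}B^T\\-2Q&-A^T+\frac\alpha2I_n\end{bmatrix}.$$ If $H_0$ is hyperbolic, then $H_\alpha$ is hyperbolic when $$\alpha<\delta_0:=2\,\mathrm{dist}(\sigma_-(H_0),\mathrm{Im}).$$
   Context: $A\in\mathbb R^{n\times n}$, $B\in\mathbb R^{n\times m}$ are real matrices (in the paper $A=\frac{\partial f}{\partial x}(0)$ and $B=g(0)$ for a control system $\dot x=f(x)+g(x)u+k(x)d$ with $f(0)=0$); $Q\in\mathbb R^{n\times n}$ and $W\in\mathbb R^{m\times m}$ are (symmetric) positive-definite. A matrix is hyperbolic if it has no eigenvalue on the imaginary axis. $\mathrm{Im}$ denotes the imaginary axis, $\sigma_-(H_0)$ the set of eigenvalues of $H_0$ with negative real parts, and $\mathrm{dist}$ the distance in $\mathbb C$. $\alpha$ is a discount factor, hence nonnegative. *)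

(* Defs.v *)
From mathcomp Require Import all_boot all_order all_algebra.
From mathcomp Require Import complex.
From mathcomp Require Import classical_sets reals ereal.
Set Implicit Arguments.
Unset Strict Implicit.
Unset Printing Implicit Defensive.
Import Order.TTheory GRing.Theory Num.Theory.
Local Open Scope classical_set_scope.
Local Open Scope ring_scope.

Definition posdef_mx (R : realType) (n : nat) (M : 'M[R]_n) : Prop :=
  M^T = M /\ forall x : 'cV[R]_n, x != 0 -> 0 < (x^T *m M *m x) 0 0.

(* [eigenvalue] only looks for eigenvalues in the coefficient field, so a real
   matrix is first complexified. *)
Definition spectrum (R : realType) (n : nat) (M : 'M[R]_n) : set R[i] :=
  [set z | eigenvalue (map_mx (real_complex R) M) z].

Definition imaginary_axis (R : realType) : set R[i] :=
  [set z | complex.Re z = 0].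
Arguments imaginary_axis R : clear implicits.

Definition hyperbolic_mx (R : realType) (n : nat) (M : 'M[R]_n) : Prop :=
  spectrum M `&` imaginary_axis R = set0.

Definition spectrum_neg (R : realType) (n : nat) (M : 'M[R]_n) : set R[i] :=
  [set z | spectrum M z /\ complex.Re z < 0].

(* Extended-real valued: the distance to an empty set is +oo. The norm of the
   type R[i] takes its (real) values in R[i], hence [normc], which is R-valued. *)
Definition set_dist (R : realType) (X Y : set R[i]) : \bar R :=
  ereal_inf [set (Normc.normc (z - w))%:E | z in X & w in Y].

Definition H0_mx (R : realType) (n m : nat) (A : 'M[R]_n) (B : 'M[R]_(n, m))
    (Q : 'M[R]_n) (W : 'M[R]_m) : 'M[R]_(n + n) :=
  block_mx A            (- (2^-1 *: (B *m invmx W *m B^T)))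
           (- (2 *: Q)) (- A^T).

Definition Halpha_mx (R : realType) (n m : nat) (A : 'M[R]_n)
    (B : 'M[R]_(n, m)) (Q : 'M[R]_n) (W : 'M[R]_m) (alpha : R) :
    'M[R]_(n + n) :=
  block_mx (A - (alpha / 2)%:M) (- (2^-1 *: (B *m invmx W *m B^T)))
           (- (2 *: Q))         (- A^T + (alpha / 2)%:M).

Definition delta0 (R : realType) (n m : nat) (A : 'M[R]_n)
    (B : 'M[R]_(n, m)) (Q : 'M[R]_n) (W : 'M[R]_m) : \bar R :=
  (2%:E * set_dist (spectrum_neg (H0_mx A B Q W)) (imaginary_axis R))%E.

(* Main.v *)
Require Import Defs.
From mathcomp Require Import all_boot all_order all_algebra.
From mathcomp Require Import complex.
From mathcomp Require Import classical_sets reals ereal.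
Import Order.TTheory GRing.Theory Num.Theory.
Local Open Scope ring_scope.

(** Write [G = B W^-1 B^T] and [c = alpha / 2]. The perturbation from [H_0] to
    [H_alpha] is not normal, so the distance of [sigma_-(H_0)] to the imaginary
    axis does not by itself control the imaginary eigenvalues of [H_alpha]; the
    Hamiltonian structure does.

    Let [z] be an imaginary eigenvalue of [H_alpha], with column eigenvector
    [(x, y)]:
      [A x = (z + c) x + G y / 2]   and   [A^T y = - (z - c) y - 2 Q x].
    As [z] is imaginary, [z + c] is the conjugate of [- (z - c)], so the
    adjoint of the second equation has the same leading coefficient as the
    first. Evaluating [y^* A x] in these two ways, the terms in [y^* x] cancel
    and there remains
      [y^* G y / 2 = - 2 x^* Q x].
    The left side is nonnegative and [Q] is positive definite, so [x = 0], and
    then [G y = 0] by the first equation. Hence [(0, y)] is an eigenvector of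
    [H_0] for [z - c] ([spectrum_Halpha_imaginary]).

    If [alpha = 0] this contradicts the hyperbolicity of [H_0]. If [alpha > 0],
    then [z - c] lies in [sigma_-(H_0)] at distance [c] from the point [z] of
    the axis, so that [delta_0 <= 2 c = alpha] ([delta0_le]). *)

(** [eigenvalue] is defined by row vectors. In the row convention an imaginary
    eigenvalue [z] of [H_alpha] would lead to the eigenvalue [z + c] of [H_0],
    on the wrong side of the axis; columns give [z - c] directly. *)
Lemma eigenvalue_colP (F : fieldType) (n : nat) (M : 'M[F]_n) (z : F) :
  reflect (exists2 x : 'cV[F]_n, M *m x = z *: x & x != 0) (eigenvalue M z).
Proof.
have -> : eigenvalue M z = eigenvalue M^T z.
  rewrite /eigenvalue /eigenspace !kermx_eq0 -!row_leq_rank -[in RHS]mxrank_tr.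
  by rewrite linearB /= trmxK tr_scalar_mx.
apply: (iffP eigenvalueP) => -[x Mx x0]; exists x^T; rewrite ?trmx_eq0 //.
- by rewrite -[M]trmxK -trmx_mul Mx linearZ.
- by rewrite -trmx_mul Mx linearZ.
Qed.

Definition complexify_mx (R : rcfType) (p q : nat) (M : 'M[R]_(p, q)) :
  'M[R[i]]_(p, q) := map_mx (real_complex R) M.
Arguments complexify_mx {R p q} M.

Definition adjoint_mx (R : rcfType) (p q : nat) (M : 'M[R[i]]_(p, q)) :
  'M[R[i]]_(q, p) := (map_mx (@conjc R) M)^T.
Arguments adjoint_mx {R p q} M.

Lemma adjoint_mxM (R : rcfType) (p q r : nat) (M : 'M[R[i]]_(p, q))
    (N : 'M[R[i]]_(q, r)) :
  adjoint_mx (M *m N) = adjoint_mx N *m adjoint_mx M.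
Proof. by rewrite /adjoint_mx map_mxM trmx_mul. Qed.

Lemma adjoint_mxB (R : rcfType) (p q : nat) (M N : 'M[R[i]]_(p, q)) :
  adjoint_mx (M - N) = adjoint_mx M - adjoint_mx N.
Proof. by rewrite /adjoint_mx map_mxB linearB. Qed.

Lemma adjoint_mxZ (R : rcfType) (p q : nat) (a : R[i]) (M : 'M[R[i]]_(p, q)) :
  adjoint_mx (a *: M) = conjc a *: adjoint_mx M.
Proof. by rewrite /adjoint_mx map_mxZ linearZ. Qed.

Lemma adjoint_complexify (R : rcfType) (p q : nat) (M : 'M[R]_(p, q)) :
  adjoint_mx (complexify_mx M) = complexify_mx M^T.
Proof. by apply/matrixP => i j; rewrite !mxE conjc_real. Qed.

(** With [x = u + i v], the cross terms [u^T M v] and [v^T M u] only enter the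
    imaginary part, so definiteness over the reals passes to complex vectors. *)
Lemma Re_quadratic_form (R : rcfType) (n : nat) (M : 'M[R]_n)
    (x : 'cV[R[i]]_n) :
  let u := map_mx (@complex.Re R) x in
  let v := map_mx (@complex.Im R) x in
  complex.Re ((adjoint_mx x *m complexify_mx M *m x) 0 0)
    = (u^T *m M *m u) 0 0 + (v^T *m M *m v) 0 0.
Proof.
move=> u v.
have xE : x = complexify_mx u + 'i%C *: complexify_mx v.
  by apply/matrixP => i j; rewrite !mxE -complexE.
have sxE : adjoint_mx x = complexify_mx u^T - 'i%C *: complexify_mx v^T.
  apply/matrixP => i j; rewrite !mxE.
  by case: (x _ _) => a b; simpc.
rewrite sxE [in LHS]xE !(mulmxDl, mulmxDr, mulNmx) -!scalemxAl -!scalemxAr.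
rewrite -!map_mxM /= !mxE; simpc.
by [].
Qed.

Lemma Re_quadratic_form_gt0 (R : realType) (n : nat) (M : 'M[R]_n)
    (x : 'cV[R[i]]_n) :
  posdef_mx M -> x != 0 ->
  0 < complex.Re ((adjoint_mx x *m complexify_mx M *m x) 0 0).
Proof.
move=> [_ Mpos] x0; rewrite Re_quadratic_form.
have Mge0 (w : 'cV[R]_n) : 0 <= (w^T *m M *m w) 0 0.
  have [->|/Mpos/ltW//] := eqVneq w 0.
  by rewrite mulmx0 mxE.
have [u0|/Mpos] := eqVneq (map_mx (@complex.Re R) x) 0; last first.
  by move=> ?; apply: ltr_wpDr.
have [v0|/Mpos] := eqVneq (map_mx (@complex.Im R) x) 0; last first.
  by move=> ?; apply: ltr_wpDl.
case/eqP: x0; apply/matrixP => i j; rewrite mxE; apply/eqP; rewrite eq_complex.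
have /matrixP/(_ i j) := u0; have /matrixP/(_ i j) := v0; rewrite !mxE => -> ->.
by rewrite !eqxx.
Qed.

Lemma posdef_unitmx (R : realType) (n : nat) (M : 'M[R]_n) :
  posdef_mx M -> M \in unitmx.
Proof.
move=> [_ Mpos]; rewrite -row_free_unit -kermx_eq0.
apply/rowV0P => w /sub_kermxP wM.
apply/eqP; apply: contraT; rewrite -trmx_eq0 => /Mpos.
by rewrite trmxK wM mul0mx mxE ltxx.
Qed.

(** Substituting [x = W^-1 B^T y] turns the form of [B W^-1 B^T] at [y] into
    the form of [W] at [x], by the symmetry of [W]. *)
Lemma Re_control_form_ge0 (R : realType) (n m : nat) (B : 'M[R]_(n, m))
    (W : 'M[R]_m) (y : 'cV[R[i]]_n) :
  posdef_mx W ->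
  0 <= complex.Re
         ((adjoint_mx y *m complexify_mx (B *m invmx W *m B^T) *m y) 0 0).
Proof.
move=> Wpos; have Wunit := posdef_unitmx _ _ _ Wpos; case: (Wpos) => Wsym _.
have -> : adjoint_mx y *m complexify_mx (B *m invmx W *m B^T) *m y =
    let x := complexify_mx (invmx W *m B^T) *m y in
    adjoint_mx x *m complexify_mx W *m x.
  rewrite /= adjoint_mxM adjoint_complexify trmx_mul trmxK trmx_inv Wsym.
  rewrite !mulmxA -(mulmxA _ (complexify_mx _) (complexify_mx W)) -map_mxM.
  rewrite -(mulmxA _ (complexify_mx _) (complexify_mx (invmx _ *m _))).
  by rewrite -map_mxM /= mulmxA mulmxKV.
move=> /=; set x := _ *m y.
have [->|/(Re_quadratic_form_gt0 _ _ _ _ Wpos)/ltW//] := eqVneq x 0.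
by rewrite mulmx0 mxE lexx.
Qed.

Lemma imaginary_conjc (R : rcfType) (z : R[i]) :
  complex.Re z = 0 -> conjc z = - z.
Proof. by case: z => a b /= ->; simpc. Qed.

(** An imaginary eigenvalue of [H_alpha] can only come from an uncontrollable
    mode [y], one with [B W^-1 B^T y = 0]. On such a mode [H_0] and [H_alpha]
    both act through their lower right blocks, which differ by [alpha / 2]. *)
Lemma spectrum_Halpha_imaginary (R : realType) (n m : nat) (A : 'M[R]_n)
    (B : 'M[R]_(n, m)) (Q : 'M[R]_n) (W : 'M[R]_m) (alpha : R) (z : R[i]) :
  posdef_mx Q -> posdef_mx W ->
  spectrum (Halpha_mx A B Q W alpha) z -> imaginary_axis R z ->
  spectrum (H0_mx A B Q W) (z - (real_complex R (alpha / 2))).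
Proof.
move=> Qpos Wpos /eigenvalue_colP[w Hw w0] zI.
have [Qsym _] := Qpos.
set c := real_complex R _.
set G := B *m invmx W *m B^T.
set x := usubmx w; set y := dsubmx w.
have wE : w = col_mx x y by rewrite vsubmxK.
move: Hw; rewrite wE /Halpha_mx map_block_mx mul_block_col scale_col_mx.
move=> /eq_col_mx[].
rewrite !(map_mxD, map_mxN, map_mxZ, map_scalar_mx).
rewrite -/G -/(complexify_mx _) -/c /=.
rewrite -/(complexify_mx Q) -/(complexify_mx G) -/(complexify_mx A^T).
rewrite !mulmxDl !mulNmx !mul_scalar_mx -!scalemxAl => Ex Ey.
have {}Ex : complexify_mx A *m x
    = (z + c) *: x + (real_complex R 2^-1) *: (complexify_mx G *m y).
  by rewrite scalerDl -Ex addrAC subrK addrNK.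
have {}Ey : complexify_mx A^T *m y
    = - (z - c) *: y - (real_complex R 2) *: (complexify_mx Q *m x).
  rewrite scaleNr scalerBl -Ey addrA addrK opprD opprK.
  by rewrite opprK addrAC subrr add0r.
have conj_cz : conjc (- (z - c)) = z + c.
  by rewrite opprB rmorphB /= (imaginary_conjc _ _ zI) opprK oppr0 addrC.
(* The adjoint of [Ey] sees [A] again, with the coefficient [z + c] of [Ex]. *)
have Ey' : adjoint_mx y *m complexify_mx A
    = (z + c) *: adjoint_mx y
      - (real_complex R 2) *: (adjoint_mx x *m complexify_mx Q).
  rewrite -[A in LHS]trmxK -adjoint_complexify -adjoint_mxM Ey.
  rewrite -[Q in RHS]Qsym -adjoint_complexify -adjoint_mxM.
  by rewrite adjoint_mxB !adjoint_mxZ conjc_real conj_cz.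
(* [y^* A x] computed from [Ex] and from [Ey']. *)
have balance : (real_complex R 2^-1)
      *: (adjoint_mx y *m complexify_mx G *m y)
    = - (real_complex R 2) *: (adjoint_mx x *m complexify_mx Q *m x).
  have := congr1 (mulmx (adjoint_mx y)) Ex.
  rewrite mulmxA Ey' mulmxBl mulmxDr -!scalemxAl -!scalemxAr.
  by move=> /addrI; rewrite -(mulmxA _ _ y) scaleNr => <-.
have x0 : x = 0.
  apply: contraTeq (Re_control_form_ge0 _ _ _ B W y Wpos) => x0.
  have := Re_quadratic_form_gt0 _ _ _ _ Qpos x0.
  have /matrixP/(_ 0 0) := balance; rewrite [LHS]mxE [RHS]mxE -/G.
  move=> /(congr1 (@complex.Re R)).
  (* The factors 1/2 and 2 are real, so real parts give [a / 2 = - 2 a']. *)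
  case: ((_ *m _ *m y) 0 0) => a b; case: ((_ *m _ *m x) 0 0) => a' b'.
  rewrite /=; simpc => /= H a'0.
  rewrite -ltNge -(pmulr_rlt0 _ (_ : 0 < 2^-1)) ?invr_gt0 ?ltr0n // H.
  by rewrite oppr_lt0 mulr_gt0 ?ltr0n.
have Gy : (real_complex R 2^-1) *: (complexify_mx G *m y) = 0.
  by move: Ex; rewrite x0 mulmx0 scaler0 add0r => <-.
apply/eigenvalue_colP; exists (col_mx 0 y); last first.
  by apply: contra_neq w0 => y0; rewrite wE x0.
rewrite map_block_mx mul_block_col scale_col_mx !mulmx0 scaler0 !add0r.
rewrite !map_mxN map_mxZ -/(complexify_mx G) -/(complexify_mx A^T).
rewrite !mulNmx -scalemxAl Gy oppr0 Ey x0 mulmx0 scaler0 subr0.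
by rewrite scaleNr opprK.
Qed.

(** Shifting [z - c] horizontally back to [z] bounds its distance to the axis. *)
Lemma delta0_le (R : realType) (n m : nat) (A : 'M[R]_n)
    (B : 'M[R]_(n, m)) (Q : 'M[R]_n) (W : 'M[R]_m) (z : R[i]) (c : R) :
  0 < c -> imaginary_axis R z ->
  spectrum (H0_mx A B Q W) (z - real_complex R c) ->
  (delta0 A B Q W <= (2 * c)%:E)%E.
Proof.
move=> c0 zI zc; rewrite EFinM lee_pmul2l // ?lte_fin ?ltr0n //.
apply: ereal_inf_lbound; exists (z - real_complex R c).
  have Rez : complex.Re z = 0 by [].
  by split=> //; case: z Rez {zI zc} => a b /= ->; rewrite sub0r oppr_lt0.
exists z => //; congr EFin.
by rewrite addrAC subrr sub0r /= oppr0 expr0n addr0 sqrrN sqrtr_sqr gtr0_norm.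
Qed.

Theorem lemma4p1 (R : realType) (n m : nat) (A : 'M[R]_n) (B : 'M[R]_(n, m))
    (Q : 'M[R]_n) (W : 'M[R]_m) (alpha : R) :
  posdef_mx Q -> posdef_mx W -> 0 <= alpha ->
  hyperbolic_mx (H0_mx A B Q W) ->
  (alpha%:E < delta0 A B Q W)%E ->
  hyperbolic_mx (Halpha_mx A B Q W alpha).
Proof.
move=> Qpos Wpos alpha_ge0 hyp0 alpha_lt.
apply/seteqP; split=> // z [zH zI].
have zc := spectrum_Halpha_imaginary _ _ _ _ _ _ _ _ _ Qpos Wpos zH zI.
move: alpha_ge0; rewrite le_eqVlt => /orP[/eqP alpha0|alpha_gt0].
  have: (spectrum (H0_mx A B Q W) `&` imaginary_axis R)%classic z.
    split; last exact: zI.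
    have c0 : real_complex R (alpha / 2) = 0 by rewrite -alpha0 mul0r.
    by rewrite c0 subr0 in zc.
  by rewrite hyp0.
have /(delta0_le _ _ _ _ _ _ _ _ _)/(_ zI zc) : 0 < alpha / 2.
  by rewrite divr_gt0 ?ltr0n.
by rewrite mulrC divfK ?pnatr_eq0 // leNgt alpha_lt.
Qed.
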